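(* Let $n>3$ and let $\mathbb{P}_n$ be the pancake graph. Then \[ \gamma(\mathbb{P}_n)\leq n!\left(\frac{3n-10}{12}\right)+1 . \]
   Context: For a graph $G$, $\gamma(G)$ denotes its genus: the minimum genus of a closed orientable surface on which $G$ can be embedded without edge crossings. The pancake graph $\mathbb{P}_n$ is the simple undirected graph whose vertex set is the symmetric group $S_n$, with permutations written as words $\pi_1\pi_2\cdots\pi_n$. For $2\le i\le n$ the prefix reversal $r_i$ maps $\pi_1\cdots\pi_n$ to $\pi_i\pi_{i-1}\cdots\pi_1\pi_{i+1}\cdots\pi_n$. Two vertices $\pi,\sigma$ are adjacent iff $\sigma=r_i(\pi)$ for some $2\le i\le n$. Hence $\mathbb{P}_n$ has $n!$ vertices and $(n-1)n!/2$ edges. *)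

(* Defs.v *)
From HB Require Import structures.
From mathcomp Require Import all_boot all_order all_algebra all_fingroup.
From mathcomp Require Import all_classical all_reals all_analysis.
Import Order.TTheory GRing.Theory Num.Theory.
Import numFieldNormedType.Exports.

Set Implicit Arguments.
Unset Strict Implicit.
Unset Printing Implicit Defensive.

Local Open Scope classical_set_scope.
Local Open Scope ring_scope.

Record sgraph := SGraph {
  vertex :> finType;
  adj : rel vertex;
  adj_sym : symmetric adj;
  adj_irrefl : irreflexive adj }.

(* Combinatorial closed surfaces, given by the set F of triangles of a finite
   two-dimensional simplicial complex on the vertex set V. *)
Section ClosedSurface.
Variables (V : finType) (F : {set {set V}}).

Definition triangulation_edges : {set {set V}} :=
  [set s : {set V} | (#|s| == 2%N) && [exists t in F, s \subset t]]%SET.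

Definition edge_rel : rel V :=
  fun x y => [set x; y]%SET \in triangulation_edges.

(* The edge y z lies opposite to x in a triangle; members of F have three
   elements, so x, y, z are then distinct. *)
Definition link_rel (x : V) : rel V := fun y z => [set x; y; z]%SET \in F.

(* An edge lies in exactly two triangles, so every link is 2-regular; being
   connected, it is a single cycle, i.e. the complex is locally a disc. *)
Definition closed_surface : Prop :=
  [/\ F != finset.set0 /\ finset.cover F = [set: V]%SET,
      forall t, t \in F -> #|t| = 3%N,
      forall s, s \in triangulation_edges ->
        #|[set t in F | s \subset t]%SET| = 2%N,
      forall x y z, edge_rel x y -> edge_rel x z -> connect (link_rel x) y z
    & forall x y, connect edge_rel x y].

(* o x y z means that the triangle xyz is positively oriented, and hence that
   it induces the direction x -> y on its edge xy.  Two triangles sharing an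
   edge must induce opposite directions on it. *)
Definition coherent_orientation (o : V -> V -> V -> bool) : Prop :=
  forall x y z, [set x; y; z]%SET \in F ->
    [/\ o y z x = o x y z,
        o y x z = ~~ o x y z
      & forall w, [set x; y; w]%SET \in F -> w != z -> o x y w = ~~ o x y z].

Definition orientable : Prop := exists o, coherent_orientation o.

Definition euler_characteristic : int :=
  #|V|%:Z - #|triangulation_edges|%:Z + #|F|%:Z.

(* Geometric realization in barycentric coordinates. *)
Definition realization (R : realType) : set {ptws V -> R} :=
  [set p | [/\ forall x, 0 <= p x, \sum_x p x = 1
             & exists2 t, t \in F & forall x, p x != 0 -> x \in t]].

End ClosedSurface.

Arguments realization {V} F R.

Definition homeomorphic (S T : topologicalType) : Prop :=
  exists (f : S -> T) (h : T -> S),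
    [/\ cancel f h, cancel h f, continuous f & continuous h].

(* Closed surfaces are triangulable (Rado), and the orientable one with g
   handles is determined by its Euler characteristic 2 - 2g. *)
Definition closed_orientable_surface
    (R : realType) (g : nat) (S : topologicalType) : Prop :=
  exists (V : finType) (F : {set {set V}}),
    [/\ closed_surface F, orientable F,
        euler_characteristic F = 2 - 2 * g%:Z
      & homeomorphic S (set_type (realization F R))].

(* Crossing-free drawing: v x is the point representing x, and a x y is a
   parametrization by [0, 1] of the simple arc representing the edge xy,
   run from x to y. *)
Definition embedding (R : realType) (G : sgraph) (S : topologicalType)
    (v : G -> S) (a : G -> G -> R -> S) : Prop :=
  [/\ injective v,
      forall x y, adj x y ->
        [/\ {within `[0, 1], continuous (a x y)},
            {in `[0, 1] &, injective (a x y)},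
            a x y 0 = v x, a x y 1 = v y
          & {in `[0, 1], forall t, a y x t = a x y (1 - t)}],
      forall x y z, adj x y -> {in `]0, 1[, forall t, a x y t <> v z}
    & forall x y x' y', adj x y -> adj x' y' ->
        {in `]0, 1[ &, forall s t, a x y s = a x' y' t ->
          [set x; y]%SET = [set x'; y']%SET}].

Definition embeddable_in_genus (R : realType) (G : sgraph) (g : nat) : Prop :=
  exists S : topologicalType, closed_orientable_surface R g S /\
    exists (v : G -> S) (a : G -> G -> R -> S), embedding v a.

Definition is_genus (R : realType) (G : sgraph) (g : nat) : Prop :=
  embeddable_in_genus R G g /\
  forall g', embeddable_in_genus R G g' -> (g <= g')%N.

Definition prefix_reversal (T : Type) (i : nat) (w : seq T) : seq T :=
  rev (take i w) ++ drop i w.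

Section Pancake.
Variable n : nat.

(* codom p is the word p(0) p(1) ... p(n-1). *)
Definition pancake_adj : rel {perm 'I_n} := fun p q =>
  [exists i : 'I_n.+1, (2 <= i)%N && (codom q == prefix_reversal i (codom p))].

Lemma pancake_adj_sym : symmetric pancake_adj.
Proof.
suff H p q : pancake_adj p q -> pancake_adj q p.
  by move=> p q; apply/idP/idP; apply: H.
move=> /existsP[i /andP[i2 /eqP E]]; apply/existsP; exists i; rewrite i2 /=.
have si : size (take i (codom p)) = i.
  by rewrite size_takel // size_codom card_ord -ltnS.
rewrite E /prefix_reversal take_size_cat ?size_rev //.
by rewrite drop_size_cat ?size_rev // revK cat_take_drop.
Qed.

Lemma pancake_adj_irrefl : irreflexive pancake_adj.
Proof.
move=> p; apply/negbTE/existsP => -[i /andP[i2 /eqP E]].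
have i0 : (0 < i)%N by apply: leq_trans i2.
have ile : (i <= n)%N by rewrite -ltnS.
have n0 : (0 < n)%N by apply: leq_trans ile.
pose x0 := p (Ordinal n0).
have sz : size (codom p) = n by rewrite size_codom card_ord.
have U : uniq (codom p) by apply/injectiveP/perm_inj.
have st : size (take i (codom p)) = i by rewrite size_takel // sz.
have : nth x0 (codom p) 0 = nth x0 (codom p) i.-1.
  rewrite {1}E nth_cat size_rev st i0 nth_rev ?st // nth_take ?subn1 //.
  by rewrite prednK.
move/eqP; rewrite nth_uniq ?sz //; last by rewrite prednK.
by case: (nat_of_ord i) i2 => [|[]].
Qed.

Definition pancake : sgraph := SGraph pancake_adj_sym pancake_adj_irrefl.

End Pancake.

(* Main.v *)
(* Each vertex of the pancake graph lies on exactly one hexagon whose edges are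
   alternately r_2 and r_3; there are n!/6 of them.  Both reversals are odd
   permutations, so rotating r_2, r_3, ..., r_n cyclically in this order at the
   even permutations and in the opposite order at the odd ones makes all these
   hexagons faces of the resulting rotation system.  Euler's formula with at
   least n!/6 faces is the bound.  That V - E + F is even and at most 2 comes
   from building the edge involution up by transpositions: each one merges or
   splits two cycles of the current permutation, and connectedness forces at
   least V - 1 merges. *)
From HB Require Import structures.
Require Import Defs.
From mathcomp Require Import all_boot all_order all_algebra all_fingroup.
From mathcomp Require Import all_classical all_reals all_analysis.
From mathcomp Require Import zify lra.

Set Implicit Arguments.
Unset Strict Implicit.
Unset Printing Implicit Defensive.

Import Order.TTheory GRing.Theory Num.Theory.
Import numFieldNormedType.Exports.

(** * Oriented triangulations from half-edges *)

(* A half-edge x runs from [org x] to [org (nx x)]; [nx] walks around its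
   triangle and [tw] reverses it.  [apex_neq] excludes two triangles glued
   along all three sides, [rotation_trans] makes every link a single cycle. *)
Section HalfEdges.
Local Open Scope set_scope.
Local Open Scope nat_scope.
Variables (X V : finType) (nx tw : X -> X) (org : X -> V).
Hypothesis nxK : forall x, nx (nx (nx x)) = x.
Hypothesis twK : involutive tw.
Hypothesis org_tw : forall x, org (tw x) = org (nx x).
Hypothesis org_nx_neq : forall x, org x != org (nx x).
Hypothesis org_inj : forall x y, org x = org y -> org (nx x) = org (nx y) -> x = y.
Hypothesis apex_neq : forall x, org (nx (nx (tw x))) != org (nx (nx x)).
Hypothesis org_surj : forall v, exists x, org x = v.
Hypothesis rotation_trans : forall x y, org x = org y ->
  fconnect (fun u => tw (nx (nx u))) x y.

Definition half_edge_triangle x := [set org x; org (nx x); org (nx (nx x))].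

Definition half_edge_triangles : {set {set V}} :=
  [set half_edge_triangle x | x in X].

Local Notation tri := half_edge_triangle.
Local Notation F := half_edge_triangles.

Lemma triangle_nx x : tri (nx x) = tri x.
Proof.
rewrite /tri nxK; apply/setP=> v; rewrite !inE.
by rewrite orbC orbA.
Qed.

Lemma mem_triangles x : tri x \in F.
Proof. exact: imset_f. Qed.

Lemma org_nx_tw x : org (nx (tw x)) = org x.
Proof. by rewrite -org_tw twK. Qed.

Lemma org_nx2_neq x : org x != org (nx (nx x)).
Proof. by rewrite eq_sym -{2}(nxK x) org_nx_neq. Qed.

Lemma card_triangle x : #|tri x| = 3.
Proof.
rewrite /tri -finset.setUA cardsU1 cards2 !inE negb_or.
by rewrite !org_nx_neq org_nx2_neq.
Qed.

Lemma triangle_rot x y : y \in [:: x; nx x; nx (nx x)] -> tri y = tri x.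
Proof. by rewrite !inE => /or3P[] /eqP->; rewrite ?triangle_nx. Qed.

Lemma triangle_side x a b : a \in tri x -> b \in tri x -> a != b ->
  exists2 y, y \in [:: x; nx x; nx (nx x)] &
    (org y = a /\ org (nx y) = b) \/ (org y = b /\ org (nx y) = a).
Proof.
rewrite /tri !inE => /orP[/orP[]|] /eqP-> /orP[/orP[]|] /eqP->; rewrite ?eqxx // => _.
- by exists x; rewrite ?inE ?eqxx; [|left].
- by exists (nx (nx x)); rewrite ?inE ?eqxx ?orbT // nxK; right.
- by exists x; rewrite ?inE ?eqxx; [|right].
- by exists (nx x); rewrite ?inE ?eqxx ?orbT //; left.
- by exists (nx (nx x)); rewrite ?inE ?eqxx ?orbT // nxK; left.
- by exists (nx x); rewrite ?inE ?eqxx ?orbT //; right.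
Qed.

(** The side of [tri y] joining these two points has the ends of [x], so [org_inj] identifies it
    with [x] or [tw x] according to its direction. *)
Lemma triangle_half_edge x y : org x \in tri y -> org (nx x) \in tri y ->
  tri y = tri x \/ tri y = tri (tw x).
Proof.
move=> xy nxy; have [z /triangle_rot <-] := triangle_side xy nxy (org_nx_neq x).
case=> -[e1 e2]; [left | right].
  by rewrite (org_inj e1 e2).
by rewrite (@org_inj z (tw x)) // ?org_tw // org_nx_tw.
Qed.

Lemma triangles_of_edge x :
  [set t in F | [set org x; org (nx x)] \subset t] = [set tri x; tri (tw x)].
Proof.
apply/setP=> t; rewrite !inE; apply/andP/orP.
  case=> /imsetP[y _ ->]; rewrite finset.subUset !finset.sub1set => /andP[h1 h2].
  by case: (triangle_half_edge h1 h2) => ->; [left|right].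
case=> /eqP->; split; rewrite ?mem_triangles // finset.subUset !finset.sub1set /tri !inE.
  by rewrite !eqxx orbT.
by rewrite org_tw org_nx_tw !eqxx !orbT.
Qed.

Lemma triangle_tw_neq x : tri x != tri (tw x).
Proof.
apply/eqP=> e; have : org (nx (nx (tw x))) \in tri x by rewrite e /tri !inE eqxx !orbT.
rewrite !inE (negbTE (apex_neq x)) orbF -{1}(org_nx_tw x) -{1}(org_tw x).
rewrite ![org (nx (nx (tw x))) == _]eq_sym.
by rewrite (negbTE (org_nx_neq _)) (negbTE (org_nx2_neq _)).
Qed.

Lemma edgesP s :
  reflect (exists x, s = [set org x; org (nx x)]) (s \in triangulation_edges F).
Proof.
rewrite inE; apply: (iffP andP).
  case=> /cards2P[a [b [ab ->]]] /existsP[t /andP[/imsetP[x _ ->]]].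
  rewrite finset.subUset !finset.sub1set => /andP[ax bx].
  have [y _ [[<- <-]|[<- <-]]] := triangle_side ax bx ab; exists y => //.
  by rewrite finset.setUC.
case=> x ->; split; first by rewrite cards2 org_nx_neq.
apply/existsP; exists (tri x); rewrite mem_triangles finset.subUset.
rewrite !finset.sub1set /tri !inE.
by rewrite !eqxx orbT.
Qed.

Lemma edge_relP a b :
  reflect (exists x, org x = a /\ org (nx x) = b) (edge_rel F a b).
Proof.
rewrite /edge_rel; apply: (iffP (edgesP _)) => -[x e]; last first.
  by exists x; case: e => <- <-.
have ne := org_nx_neq x.
have := set21 (org x) (org (nx x)); have := set22 (org x) (org (nx x)).
rewrite -!e !inE => /orP[]/eqP e1 /orP[]/eqP e2; move: ne; rewrite ?e1 ?e2 ?eqxx //.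
  by exists (tw x); rewrite org_tw org_nx_tw.
by exists x.
Qed.

Lemma triangle_mem_oriented a b c : [set a; b; c] \in F ->
  exists x, [/\ org x = a, org (nx x) = b & org (nx (nx x)) = c] \/
            [/\ org x = b, org (nx x) = a & org (nx (nx x)) = c].
Proof.
case/imsetP=> y _ e.
have c3 : #|[set a; b; c]| = 3 by rewrite e card_triangle.
have /and3P[ab ac bc]: [&& a != b, a != c & b != c].
  move: c3; rewrite -finset.setUA cardsU1 cards2 !inE negb_or.
  by case: (a != b); case: (a != c); case: (b != c).
have ay : a \in tri y by rewrite -e !inE eqxx.
have hb : b \in tri y by rewrite -e !inE eqxx orbT.
have [z /triangle_rot ez h] := triangle_side ay hb ab; exists z.
have : c \in tri z by rewrite ez -e !inE eqxx !orbT.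
rewrite /tri !inE.
case: h => -[-> ->]; rewrite ![c == _]eq_sym (negbTE ac) (negbTE bc) /=.
  by move/eqP->; left.
by move/eqP->; right.
Qed.

Lemma half_edge_closed_surface (v0 : V) :
  (forall u v, connect (edge_rel F) u v) -> closed_surface F.
Proof.
move=> conn; split=> //.
- split.
    have [x _] := org_surj v0; apply/set0Pn; exists (tri x); exact: mem_triangles.
  apply/setP=> v; rewrite inE; have [x <-] := org_surj v.
  apply/bigcupP; exists (tri x); first exact: mem_triangles.
  by rewrite !inE eqxx.
- by move=> t /imsetP[x _ ->]; exact: card_triangle.
- move=> s /edgesP[x ->]; rewrite triangles_of_edge cards2.
  by rewrite triangle_tw_neq.
(* One rotation about [org x] replaces the far end of a half-edge by the third vertex of its
   triangle, which is one step in the link; a path of rotations thus gives a path in the link. *)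
- move=> a b c /edge_relP[x [<- <-]] /edge_relP[y [e <-]].
  have /connectP[p] := rotation_trans (esym e); elim: p x e => [|z p IH] x e /=.
    by move=> _ ->.
  case/andP=> /eqP/esym ez pz ly.
  have oz : org z = org x by rewrite ez org_tw nxK.
  apply: (connect_trans (y := org (nx z))); last first.
    by rewrite -oz; apply: IH; rewrite ?oz.
  apply: connect1; rewrite /link_rel ez org_nx_tw.
  exact: mem_triangles.
Qed.

Lemma half_edge_orientable : orientable F.
Proof.
(* A triangle is positive in the cyclic order in which [nx] runs through it. Two positive triangles
   inducing the same direction on an edge agree by [org_inj]; opposite directions belong to [x] and
   [tw x], whose apexes differ. *)
pose o a b c := [exists x, [&& org x == a, org (nx x) == b & org (nx (nx x)) == c]].
have oP a b c : reflect
    (exists x, [/\ org x = a, org (nx x) = b & org (nx (nx x)) = c]) (o a b c).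
  by apply: (iffP existsP) => -[x h]; exists x; [case/and3P: h => /eqP ? /eqP ? /eqP|
     case: h => -> -> ->; rewrite !eqxx].
have cyc a b c : o a b c -> o b c a.
  by move/oP=> [x [? ? ?]]; apply/oP; exists (nx x); rewrite nxK.
have anti a b c d : o a b c -> o b a d -> c != d.
  move=> /oP[x [ax bx <-]] /oP[y [hb ay <-]].
  have -> : y = tw x by apply: org_inj; rewrite ?org_tw ?org_nx_tw; congruence.
  by rewrite eq_sym.
have func a b c d : o a b c -> o a b d -> c = d.
  move=> /oP[x [ax bx <-]] /oP[y [hb ay <-]].
  by have -> : y = x by apply: org_inj; congruence.
have tot a b c : [set a; b; c] \in F -> o a b c \/ o b a c.
  by case/triangle_mem_oriented=> x [h|h]; [left|right]; apply/oP; exists x.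
exists o => a b c abc; split.
- by apply/idP/idP => [/cyc/cyc|/cyc].
- case: (tot _ _ _ abc) => h; rewrite h.
    by apply/negbTE/negP => h'; have := anti _ _ _ _ h h'; rewrite eqxx.
  by case h' : (o a b c) => //; have := anti _ _ _ _ h h'; rewrite eqxx.
- move=> d /tot abd dc; case: (tot _ _ _ abc) => h; rewrite ?h.
    by apply/negbTE/negP => h'; move: dc; rewrite (func _ _ _ _ h h') eqxx.
  have -> : o a b c = false.
    by apply/negbTE/negP => h'; have := anti _ _ _ _ h h'; rewrite eqxx.
  case: abd => // h'; by move: dc; rewrite (func _ _ _ _ h h') eqxx.
Qed.

(** Every fibre of [tri] consists of the three sides of one triangle: a side running against [x]
    would be [tw x], which lies in a different triangle. *)
Lemma card_half_edge_triangles : #|F| * 3 = #|X|.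
Proof.
rewrite -sum1_card -[RHS]sum1_card (partition_big_imset tri) /= big_distrl /=.
apply: eq_bigr => t /imsetP[x _ ->]; rewrite mul1n sum1dep_card.
suff -> : [set y | tri y == tri x] = [set x; nx x; nx (nx x)].
  have ne y : y != nx y by apply: contraNneq (org_nx_neq y) => <-.
  have e : nx (nx x) != x by rewrite -{2}(nxK x).
  by rewrite -finset.setUA cardsU1 cards2 !inE !ne negb_or ne eq_sym e.
apply/setP=> y; rewrite !inE; apply/eqP/idP; last first.
  by move=> /orP[/orP[]|] /eqP->; rewrite ?triangle_nx.
move=> e; have xy : org x \in tri y by rewrite e !inE eqxx.
have nxy : org (nx x) \in tri y by rewrite e !inE eqxx orbT.
have [z zy] := triangle_side xy nxy (org_nx_neq x).
case=> -[e1 e2]; last first.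
  have ez : z = tw x by apply: org_inj; rewrite ?org_tw ?org_nx_tw.
  by have /eqP[] := triangle_tw_neq x; rewrite -ez (triangle_rot zy).
move: zy; rewrite (org_inj e1 e2) !inE => /or3P[] /eqP->; rewrite ?nxK eqxx ?orbT //.
Qed.

Lemma card_half_edge_edges : #|triangulation_edges F| * 2 = #|X|.
Proof.
have -> : triangulation_edges F = [set [set org x; org (nx x)] | x in X].
  by apply/setP=> s; apply/edgesP/imsetP => -[x]; [exists x | move=> _; exists x].
rewrite -sum1_card -[RHS]sum1_card
  (partition_big_imset (fun x => [set org x; org (nx x)])) /= big_distrl /=.
apply: eq_bigr => t /imsetP[x _ ->]; rewrite mul1n sum1dep_card.
suff -> : [set y | [set org y; org (nx y)] == [set org x; org (nx x)]] = [set x; tw x].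
  rewrite cards2; suff -> : x != tw x by [].
  by apply: contraNneq (triangle_tw_neq x) => <-.
apply/setP=> y; rewrite !inE; apply/eqP/orP; last first.
  by case=> /eqP-> //; rewrite org_tw org_nx_tw finset.setUC.
move=> e; have /edge_relP[z [e1 e2]] : edge_rel F (org y) (org (nx y)).
  by apply/edgesP; exists y.
have: org y \in [set org x; org (nx x)] by rewrite -e !inE eqxx.
have: org (nx y) \in [set org x; org (nx x)] by rewrite -e !inE eqxx orbT.
have ne := org_nx_neq y.
rewrite !inE => /orP[]/eqP h2 /orP[]/eqP h1; move: (ne); rewrite ?h1 ?h2 ?eqxx // => _.
  by right; apply/eqP/org_inj; rewrite ?org_tw ?org_nx_tw.
by left; apply/eqP/org_inj.
Qed.
End HalfEdges.

(** * Cycles of the product of an involution and a permutation *)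

Section InvolutionProduct.
Local Open Scope group_scope.
Variables (T : finType) (s : {perm T}).
Implicit Types a : {perm T}.

(* [f] labels the orbits of the group generated by [s] and [a], so the
   inequality is the nonnegativity of the genus of the map ([s], [a]).
   A transposition that merges two cycles merges at most two labels. *)
Lemma involution_cycles a : (forall x, a (a x) = x) ->
  exists f : T -> T, [/\ forall x, f (s x) = f x, forall x, f (a x) = f x,
    #|porbits (a * s)| + #|porbits s| <= #|[set x | a x != x]|./2 + (#|f @: T|).*2,
    odd (#|porbits (a * s)| + #|porbits s|) = odd (#|[set x | a x != x]|./2)
    & ~~ odd #|[set x | a x != x]|]%N.
Proof.
(* Induction on the number of points moved by [a]. *)
move: {2}_.+1 (ltnSn #|[set x | a x != x]|) => m.
elim: m a => // m IH a lm aK.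
case: (set_0Vmem [set x | a x != x]) => [e|[x]].
  have -> : a = 1.
    apply/permP=> x; rewrite perm1; apply/eqP.
    by apply/negbFE; have := finset.in_set0 x; rewrite -e inE.
  have e1 : #|[set x | (1 : {perm T}) x != x]| = 0%N.
    by apply/eqP; rewrite cards_eq0; apply/eqP/setP=> x; rewrite !inE perm1 eqxx.
  (* For [a = 1] the label of [x] is a chosen point of its [s]-cycle. The default is never taken,
     since the cycle contains [x]. *)
  exists (fun x => odflt x [pick y in porbit s x]); rewrite e1 mul1g /=.
  have Hs y z : porbit s y = porbit s z ->
      odflt y [pick u in porbit s y] = odflt z [pick u in porbit s z].
    move=> ->; case: pickP => //= h; by have := h z; rewrite porbit_id.
  split=> //.
  - by move=> x; apply: Hs; have := porbit_perm s 1 x; rewrite expg1.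
  - by move=> x; rewrite perm1.
  - rewrite add0n addnn leq_double.
    rewrite -(card_in_imset (f := fun A : {set T} => [pick x in A])).
      have SI : injective (@Some T) by move=> u v [].
      rewrite -(card_imset _ SI) subset_leq_card //; apply/fintype.subsetP=> y.
      case/imsetP=> A /imsetP[x _ ->] ->; rewrite -imset_comp.
      apply/imsetP; exists x => //=; case: pickP => //= h.
      by have := h x; rewrite porbit_id.
    move=> A B /imsetP[x _ ->] /imsetP[y _ ->].
    case: pickP => [z zx|h]; last by have := h x; rewrite porbit_id.
    case: pickP => // w wy [zw]; move: zx wy.
    by rewrite zw -!eq_porbit_mem => /eqP <- /eqP <-.
  - by rewrite addnn odd_double.
rewrite inE => ax.
(* [a'] is [a] with the 2-cycle of [x] and [a x] removed. *)
pose a' := tperm x (a x) * a.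
have a'E z : a' z = if z \in [set x; a x] then z else a z.
  rewrite permM !inE; case: tpermP => [->|->|]; rewrite ?eqxx ?orbT ?aK //.
  by move=> /eqP /negbTE-> /eqP /negbTE->.
have a'K z : a' (a' z) = z.
  rewrite (a'E z); case: ifP => zi; rewrite a'E ?zi //.
  rewrite aK ifF //; apply: contraFF zi; rewrite !inE orbC.
  by rewrite (inj_eq perm_inj) => /orP[/eqP->|/eqP<-]; rewrite ?aK eqxx ?orbT.
have mv : [set z | a z != z] = [set x; a x] :|: [set z | a' z != z].
  apply/setP=> z; rewrite !inE a'E !inE; case: (eqVneq z x) => [->|] //=.
  case: (eqVneq z (a x)) => [->|] //=.
  by rewrite aK eq_sym.
have cm : #|[set z | a z != z]| = #|[set z | a' z != z]|.+2.
  rewrite mv cardsU disjoint_setI0 ?cards0 ?subn0 ?cards2 1?eq_sym ?ax //.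
  rewrite disjoint_sym; apply/pred0P=> z; rewrite !inE a'E !inE.
  by case: ifP; rewrite ?eqxx ?andbF.
have [|f [fs fa le ev ev2]] := IH a' _ a'K.
  by rewrite -ltnS (leq_trans _ lm) // cm.
have aE : a * s = tperm x (a x) * (a' * s).
  by apply/permP=> z; rewrite !permM tpermK.
have := porbits_mul_tperm (a' * s) x (a x); rewrite /= -aE [x == a x]eq_sym ax cm /=.
(* If [x] and [a x] share a cycle of [a' * s], the transposition splits it, and the two points
   already have the same label. Otherwise it merges two cycles, and [g] below identifies the two
   labels. *)
case: (boolP (x \in porbit (a' * s) (a x))) => [xin|xnin] /= cE.
  exists f; split=> //; last by rewrite negbK.
  - move=> z; have fx : f (a x) = f x.
      have [i xi] := porbitP _ _ _ xin; rewrite [in RHS]xi.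
      elim: i {xi} => [|i IHi]; first by rewrite expg0 perm1.
      by rewrite expgSr permM permM fs fa.
    case: (boolP (z \in [set x; a x])) => [|/negbTE zn].
      by rewrite !inE => /orP[] /eqP-> //; rewrite aK.
    by rewrite -(fa z) a'E zn.
  - by move: cE; rewrite addn0 => ->; rewrite addn1 !addSn ltnS.
  - by move: cE; rewrite addn0 => ->; rewrite addn1 !addSn /= ev.
pose g z := if f z == f x then f (a x) else f z.
exists g; split=> //; last by rewrite negbK.
- by move=> z; rewrite /g fs.
- move=> z; case: (boolP (z \in [set x; a x])) => [|/negbTE zn].
    by rewrite !inE => /orP[] /eqP->; rewrite ?aK /g eqxx; case: eqP => // ->.
  by rewrite /g; have := fa z; rewrite a'E zn => ->.
- have fg : #|f @: T| <= #|g @: T|.+1.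
    apply: leq_trans (_ : #|f x |: g @: T| <= _); last first.
      by rewrite cardsU1; case: (_ \notin _); rewrite ?add1n ?add0n.
    apply: subset_leq_card; apply/fintype.subsetP=> y /imsetP[z _ ->].
    rewrite !inE; case: (eqVneq (f z) (f x)) => //= ne; apply/imsetP; exists z => //.
    by rewrite /g (negbTE ne).
  move: cE le fg => /=; lia.
- by move: cE ev; rewrite addn1 addn2 => -[<-]; rewrite addSn /= => <-; rewrite negbK.
Qed.
End InvolutionProduct.

(** * Straight-line drawings in the realization of a complex *)

Section StraightLine.
Local Open Scope classical_set_scope.
Local Open Scope ring_scope.
Variables (R : realType) (V : finType) (F : {set {set V}}).

(** Arcs are functions on all of [R]; clamping keeps every value inside the realization. *)
Definition clip (t : R) : R := Num.max 0 (Num.min 1 t).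

Lemma clip_id t : t \in `[0, 1] -> clip t = t.
Proof. by rewrite in_itv /clip => /andP[t0 t1]; rewrite min_r // max_r. Qed.

Lemma clip_ge0 t : 0 <= clip t.
Proof. by rewrite /clip le_max lexx. Qed.

Lemma clip_le1 t : clip t <= 1.
Proof. by rewrite /clip ge_max ler01 ge_min lexx. Qed.

Lemma continuous_clip : continuous clip.
Proof.
move=> x; apply: (@continuous_max R R (fun=> 0 : R^o) (fun t => Num.min 1 t : R^o)).
  exact: cvg_cst.
apply: (@continuous_min R R (fun=> 1 : R^o) (fun t => t : R^o)).
  exact: cvg_cst.
exact: cvg_id.
Qed.

Definition segment (x y : V) (t : R) : {ptws V -> R} :=
  fun z => (1 - clip t) *+ (z == x) + clip t *+ (z == y).

Definition share (x y : V) := [exists s in F, (x \in s) && (y \in s)].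

Lemma segment_realization x y t : share x y -> realization F R (segment x y t).
Proof.
case/existsP=> s /and3P[sF xs ys]; split.
- move=> z; rewrite /segment addr_ge0 // mulrn_wge0 ?clip_ge0 //.
  by rewrite subr_ge0 clip_le1.
- rewrite big_split /=.
  have H (c : R) (w : V) : \sum_(z : V) c *+ (z == w) = c.
    rewrite (bigD1 w) //= eqxx big1 ?addr0 // => z /negbTE->.
    by rewrite mulr0n.
  by rewrite !H subrK.
- exists s => // z; rewrite /segment.
  case: (eqVneq z x) => [->|_] //; case: (eqVneq z y) => [->|_] //.
  by rewrite !mulr0n addr0 eqxx.
Qed.

Lemma continuous_segment x y : continuous (segment x y).
Proof.
(* The topology is that of pointwise convergence, so continuity is checked one coordinate at a
   time. *)
move=> t; apply/cvg_sup => z; move: t.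
apply/(@continuousP _ (initial_topology (@^~ z))) => _ [B oB <-].
have -> : segment x y @^-1` (@^~ z @^-1` B) =
  (fun t => (1 - clip t) *+ (z == x) + clip t *+ (z == y)) @^-1` B by [].
apply: open_comp => // t _; apply: cvgD.
  case: (z == x); last by rewrite mulr0n; exact: cvg_cst.
  by apply: cvgB; [exact: cvg_cst | exact: continuous_clip].
by case: (z == y); [exact: continuous_clip | rewrite mulr0n; exact: cvg_cst].
Qed.

Lemma segment0 x y z : segment x y 0 z = (z == x)%:R.
Proof. by rewrite /segment clip_id ?subr0 ?mul0rn ?addr0 // in_itv /= lexx ler01. Qed.

Lemma segment1 x y z : segment x y 1 z = (z == y)%:R.
Proof. by rewrite /segment clip_id ?subrr ?mul0rn ?add0r // in_itv /= lexx ler01. Qed.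

(** The support of an inner point recovers its edge. Hence an inner point is no vertex, and arcs
    sharing an inner point have the same ends. *)
Lemma segment_inner x y z t : t \in `]0, 1[ -> x != y ->
  (segment x y t z != 0) = (z \in [set x; y]%SET).
Proof.
move=> t01 xy; rewrite /segment clip_id; last exact: subset_itv_oo_cc.
move: t01; rewrite in_itv /= => /andP[t0 t1]; rewrite !inE.
case: (eqVneq z x) => [->|_] /=.
  by rewrite (negbTE xy) mulr0n addr0 subr_eq0 gt_eqF.
case: (eqVneq z y) => _ /=; first by rewrite mulr0n add0r gt_eqF.
by rewrite !mulr0n addr0 eqxx.
Qed.

Lemma segment_sym x y t : t \in `[0, 1] -> segment y x t = segment x y (1 - t).
Proof.
move=> t01; have t01' : 1 - t \in `[0, 1].
  by move: t01; rewrite !in_itv /= => /andP[t0 t1]; apply/andP; split; lra.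
apply/funext => z; rewrite /segment !clip_id // addrC.
by congr (_ *+ _ + _ *+ _); lra.
Qed.

Variables (G : sgraph) (i : G -> V).
Hypothesis i_inj : injective i.
Hypothesis i_adj : forall x y, adj x y -> share (i x) (i y).
Hypothesis i_mem : forall x, share (i x) (i x).

Lemma vertex_in_realization x : realization F R (segment (i x) (i x) 0).
Proof. exact/segment_realization/i_mem. Qed.

Definition straight_vertex x : set_type (realization F R) :=
  SigSub (mem_set (vertex_in_realization x)).

(* constant on pairs that span no edge of F *)
Definition straight_arc x y (t : R) : set_type (realization F R) :=
  match boolP (share (i x) (i y)) with
  | AltTrue h => SigSub (mem_set (segment_realization t h))
  | AltFalse _ => straight_vertex x
  end.

Lemma val_straight_arc x y t : adj x y ->
  val (straight_arc x y t) = segment (i x) (i y) t.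
Proof.
by move=> /i_adj xy; rewrite /straight_arc; case: {-}_ / boolP => // /negP.
Qed.

Lemma straight_embedding : embedding straight_vertex straight_arc.
Proof.
have ne x y : adj x y -> i x != i y.
  by move=> xy; apply: contraTneq xy => /i_inj->; rewrite adj_irrefl.
split.
- move=> x y /(congr1 (fun p => val p (i x))) /=.
  rewrite !segment0 eqxx; case: eqVneq => [/i_inj//|_] /eqP.
  by rewrite oner_eq0.
- move=> x y xy; split.
  + apply: continuous_subspaceT; apply: continuous_comp_initial.
    have -> : set_val \o straight_arc x y = segment (i x) (i y).
      by apply/funext => t; exact: val_straight_arc.
    exact: continuous_segment.
  (* The coordinate at the end [i y] is the parameter itself. *)
  + move=> s t s01 t01 /(congr1 (fun p => val p (i y))) /=.
    rewrite !val_straight_arc // /segment !clip_id // eqxx eq_sym (negbTE (ne _ _ xy)).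
    by rewrite !mulr0n !add0r.
  + by apply: val_inj; rewrite val_straight_arc //=; apply/funext=> z; rewrite !segment0.
  + apply: val_inj; rewrite val_straight_arc //=.
    by apply/funext=> z; rewrite segment1 segment0.
  + move=> t t01; apply: val_inj; rewrite !val_straight_arc //; last by rewrite adj_sym.
    exact: segment_sym.
- move=> x y z xy t t01 /(congr1 val); rewrite val_straight_arc //= => e.
  have hx : segment (i x) (i y) t (i x) != 0.
    by rewrite segment_inner ?ne // !inE eqxx.
  have hy : segment (i x) (i y) t (i y) != 0.
    by rewrite segment_inner ?ne // !inE eqxx orbT.
  move: hx hy; rewrite e !segment0 !pnatr_eq0 !eqb0 !negbK => /eqP h /eqP h'.
  by have := ne _ _ xy; rewrite h h' eqxx.
- move=> x y x' y' xy xy' s t s01 t01 /(congr1 val).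
  rewrite !val_straight_arc // => e.
  have E z : (i z \in [set i x; i y]%SET) = (i z \in [set i x'; i y']%SET).
    by rewrite -(segment_inner _ s01 (ne _ _ xy)) e segment_inner // ne.
  by apply/finset.setP => z; have := E z; rewrite !inE !(inj_eq i_inj).
Qed.

End StraightLine.

(** * The surface of a combinatorial map *)

(* In the face of a dart d, put a vertex c_d next to d and one vertex f in the
   middle of the face.  With phi d the dart following d along that face, d
   contributes the triangles
     A = (source of d, target of d, c_d),  B = (c_d, target of d, c_(phi d)),
     C = (c_d, c_(phi d), f),
   so that faces visiting a vertex repeatedly cause no double edges.  The
   constructor Ai stands for the side of A that leaves its i-th vertex. *)
Inductive corner := A0 | A1 | A2 | B0 | B1 | B2 | C0 | C1 | C2.

Definition corner_code c : nat :=
  match c with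
  | A0 => 0 | A1 => 1 | A2 => 2 | B0 => 3 | B1 => 4 | B2 => 5
  | C0 => 6 | C1 => 7 | C2 => 8
  end.

Definition corners := [:: A0; A1; A2; B0; B1; B2; C0; C1; C2].

Lemma corner_codeK : ssrfun.cancel corner_code (nth A0 corners).
Proof. by case. Qed.

HB.instance Definition _ := Countable.copy corner (can_type corner_codeK).

Lemma corners_enum : Finite.axiom corners.
Proof. by case. Qed.

HB.instance Definition _ := fintype.isFinite.Build corner corners_enum.

Lemma card_corner : #|{: corner}| = 9.
Proof. by rewrite cardT enumT unlock. Qed.

(* [src] is the vertex a dart leaves, [alpha] reverses a dart, and [sigma] is the
   rotation at its source; the faces are the cycles of [alpha * sigma]. *)
Section CombinatorialMap.
Local Open Scope group_scope.
Variables (D V : finType) (alpha sigma : {perm D}) (src : D -> V).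
Hypothesis alphaK : forall d, alpha (alpha d) = d.
Hypothesis src_sigma : forall d, src (sigma d) = src d.
Hypothesis src_porbit : forall d e, src d = src e -> d \in porbit sigma e.
Hypothesis src_surj : forall v, exists d, src d = v.
Hypothesis src_alpha_neq : forall d, src (alpha d) != src d.
Hypothesis dart_inj : forall d e,
  src d = src e -> src (alpha d) = src (alpha e) -> d = e.
Hypothesis sigma_neq : forall d, sigma d != d.
Hypothesis map_connected : forall u v,
  connect (fun u v => [exists d, (src d == u) && (src (alpha d) == v)]) u v.

Local Notation phi := (alpha * sigma).

Definition map_vertex : finType :=
  (V + (D + {f : {set D} | f \in porbits phi}))%type.

Definition map_face (d : D) : {f : {set D} | f \in porbits phi} :=
  Sub (porbit phi d) (imset_f (porbit phi) (erefl (d \in D))).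

Definition map_org (x : D * corner) : map_vertex :=
  let: (d, c) := x in
  match c with
  | A0 => inl (src d)
  | A1 | B1 => inl (src (alpha d))
  | A2 | B0 | C0 => inr (inl d)
  | B2 | C1 => inr (inl (phi d))
  | C2 => inr (inr (map_face d))
  end.

Definition map_nx (x : D * corner) : D * corner :=
  let: (d, c) := x in
  (d, match c with
      | A0 => A1 | A1 => A2 | A2 => A0
      | B0 => B1 | B1 => B2 | B2 => B0
      | C0 => C1 | C1 => C2 | C2 => C0
      end).

(** [A0] is glued across an edge of the map; [A2] with [B1] and [C1] with [C2] are glued between
    consecutive darts of a face; the remaining pairs lie within one dart. *)
Definition map_tw (x : D * corner) : D * corner :=
  let: (d, c) := x in
  match c with
  | A0 => (alpha d, A0)
  | A1 => (d, B0)
  | B0 => (d, A1)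
  | A2 => (phi^-1 d, B1)
  | B1 => (phi d, A2)
  | B2 => (d, C0)
  | C0 => (d, B2)
  | C1 => (phi d, C2)
  | C2 => (phi^-1 d, C1)
  end.

Lemma src_phi d : src (phi d) = src (alpha d).
Proof. by rewrite permM src_sigma. Qed.

Lemma phi_neq d : phi d != d.
Proof.
by apply: contraNneq (src_alpha_neq d) => e; rewrite -src_phi e.
Qed.

(** In a face of length two, [phi d] and [alpha d] would have the same ends, hence be equal, and
    [sigma] would fix [alpha d]. *)
Lemma phi2_neq d : phi (phi d) != d.
Proof.
apply/eqP=> e; have := sigma_neq (alpha d); rewrite -permM; case/eqP.
by apply: dart_inj; rewrite ?src_phi // -src_phi e alphaK.
Qed.

Lemma map_face_phi d : map_face (phi d) = map_face d.
Proof. by apply: val_inj; rewrite /= -{2}(expg1 phi) porbit_perm. Qed.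

Lemma src_phiV d : src (alpha (phi^-1 d)) = src d.
Proof. by rewrite -src_phi permKV. Qed.

Lemma map_nxK x : map_nx (map_nx (map_nx x)) = x.
Proof. by case: x => d []. Qed.

Lemma map_twK : involutive map_tw.
Proof. by case=> d [] /=; rewrite ?alphaK ?permK ?permKV. Qed.

Lemma map_org_tw x : map_org (map_tw x) = map_org (map_nx x).
Proof.
by case: x => d [] //=; rewrite ?src_phiV ?map_face_phi ?permKV ?alphaK.
Qed.

Lemma map_org_nx_neq x : map_org x != map_org (map_nx x).
Proof.
case: x => d [] //=; rewrite ?(inj_eq inl_inj) ?(inj_eq inr_inj) //.
- by rewrite eq_sym.
- by rewrite phi_neq.
- by rewrite eq_sym phi_neq.
Qed.

Lemma map_org_inj x y : map_org x = map_org y ->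
  map_org (map_nx x) = map_org (map_nx y) -> x = y.
Proof.
case: x => d; case: y => e.
have sd := src_alpha_neq d; have se := src_alpha_neq e.
case; case=> //= [] [e1] [e2]; try by
  [rewrite e1 | rewrite e2 | rewrite (perm_inj e1) | rewrite (perm_inj e2)].
all: try by rewrite (dart_inj e1 e2).
(* Of the six cases left, four pair [A1] with [B1] or [A2] with [B0] and would make a dart a loop;
   the last two pair [B2] with [C0] and would give a face of length two. *)
- by have := src_phi d; rewrite e2 e1 => e3; rewrite -e3 eqxx in se.
- by rewrite e2 e1 eqxx in sd.
- by rewrite -e2 e1 eqxx in se.
- by have := src_phi e; rewrite -e2 -e1 => e3; rewrite -e3 eqxx in sd.
- by have := phi2_neq e; rewrite -e1 e2 eqxx.
- by have := phi2_neq e; rewrite -e2 e1 eqxx.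
Qed.

Lemma map_apex_neq x :
  map_org (map_nx (map_nx (map_tw x))) != map_org (map_nx (map_nx x)).
Proof.
case: x => d [] //=; rewrite ?permKV // !(inj_eq inr_inj) !(inj_eq inl_inj).
- by apply: contraNneq (src_alpha_neq d) => ->.
- by rewrite phi2_neq.
- by have := phi2_neq (phi^-1 d); rewrite permKV 1?eq_sym.
Qed.

Lemma map_org_surj v : exists x, map_org x = v.
Proof.
case: v => [v|[d|[f ff]]].
- by have [d <-] := src_surj v; exists (d, A0).
- by exists (d, A2).
- have /imsetP[d _ fd] := ff; exists (d, C2) => /=.
  by congr (inr (inr _)); apply: val_inj.
Qed.

Lemma map_rotation_trans x y : map_org x = map_org y ->
  fconnect (fun u => map_tw (map_nx (map_nx u))) x y.
Proof.
set r := fun u => map_tw (map_nx (map_nx u)).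
have r_inj : injective r.
  by apply: (can_inj (g := fun u => map_nx (map_tw u))) => u; rewrite /r map_twK map_nxK.
have rC := fconnect_sym r_inj.
have rstep u v : r u = v -> fconnect r u v by move=> <-; exact: fconnect1.
(* Three rotations lead from [phi d] to [alpha d], so the rotation of the triangulation follows
   [sigma] backwards. *)
have A0_phi d : fconnect r (phi d, A0) (alpha d, A0).
  apply: (connect_trans (y := (d, B1))); first by apply: rstep; rewrite /r /= permK.
  by apply: (connect_trans (y := (d, A1))); apply: rstep.
have A0_sigma d : fconnect r (sigma d, A0) (d, A0).
  by have := A0_phi (alpha d); rewrite permM alphaK.
have A0_src d e : src d = src e -> fconnect r (d, A0) (e, A0).
  move/src_porbit/porbitP=> [k ->]; elim: k => [|k IH].
    by rewrite expg0 perm1.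
  by rewrite expgSr permM (connect_trans (A0_sigma _)).
have C2_face d e : porbit phi d = porbit phi e -> fconnect r (d, C2) (e, C2).
  move=> /eqP; rewrite eq_porbit_mem => /porbitP[k ->]; rewrite rC.
  elim: k => [|k IH]; first by rewrite expg0 perm1.
  by apply: connect_trans IH _; apply: rstep; rewrite expgSr permM.
(* One kind of half-edge is kept as normal form at each kind of vertex: [A0] at a vertex of the map,
   [A2] at a [c_d], [C2] at a face. Normal forms with equal origin are joined through [sigma] or
   [phi]. *)
pose std (x : D * corner) : D * corner := let: (d, c) := x in
  match c with
  | A0 => (d, A0) | A1 | B1 => (alpha d, A0)
  | A2 | B0 | C0 => (d, A2) | B2 | C1 => (phi d, A2) | C2 => (d, C2)
  end.
have B2_A2 d : fconnect r (d, B2) (phi d, A2) by apply: rstep.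
have C1_B2 d : fconnect r (d, C1) (d, B2) by apply: rstep.
have C0_A2 d : fconnect r (d, C0) (d, A2).
  apply: (connect_trans (y := (phi^-1 d, C1))); first exact: rstep.
  by apply: connect_trans (C1_B2 _) _; rewrite -{2}(permKV phi d).
have stdP u : fconnect r u (std u).
  case: u => d [] //=.
  - exact: rstep.
  - exact: connect_trans (rstep (d, B0) (d, C0) erefl) _.
  - by apply: (connect_trans (y := (d, A1))); exact: rstep.
  - exact: connect_trans (C1_B2 _) _.
move=> xy; apply: connect_trans (stdP x) _; rewrite rC.
apply: connect_trans (stdP y) _; rewrite rC.
case: x y xy => d c [e c'].
case: c; case: c' => //= -[h]; try exact: A0_src; try by rewrite h connect0.
exact: C2_face.
Qed.

Definition map_triangles := half_edge_triangles map_nx map_org.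

Lemma map_edge x : edge_rel map_triangles (map_org x) (map_org (map_nx x)).
Proof.
apply/(edge_relP map_nxK map_twK map_org_tw map_org_nx_neq).
by exists x.
Qed.

(** Each added vertex is joined to a vertex of [V], and the sides [A0] carry the paths of the
    map. *)
Lemma map_complex_connected u v : connect (edge_rel map_triangles) u v.
Proof.
have eC : connect_sym (edge_rel map_triangles).
  by apply: sym_connect_sym => a b; rewrite /edge_rel finset.setUC.
have base w : exists v', connect (edge_rel map_triangles) w (inl v').
  have cb d : connect (edge_rel map_triangles) (inr (inl d)) (inl (src d)).
    exact/connect1/(map_edge (d, A2)).
  have [[d c] <-] := map_org_surj w; case: c => /=; try by [eexists].
    exists (src d); apply: connect_trans (cb d).
    exact/connect1/(map_edge (d, C2)).
have [u' uu'] := base u; have [v' vv'] := base v.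
apply: connect_trans uu' _; rewrite eC; apply: connect_trans vv' _; rewrite eC.
have /connectP[p] := map_connected u' v'; elim: p u' => [|w p IH] u' /=.
  by move=> _ ->.
case/andP=> /existsP[d /andP[/eqP <- /eqP <-]] pw lw.
apply: connect_trans (IH _ pw lw); exact/connect1/(map_edge (d, A0)).
Qed.

Lemma map_closed_surface : V -> closed_surface map_triangles.
Proof.
move=> v0; apply: (half_edge_closed_surface map_nxK map_twK map_org_tw
  map_org_nx_neq map_org_inj map_apex_neq map_org_surj map_rotation_trans (inl v0)).
exact: map_complex_connected.
Qed.

Lemma map_orientable : orientable map_triangles.
Proof.
exact: (half_edge_orientable map_nxK map_twK map_org_tw
  map_org_nx_neq map_org_inj map_apex_neq).
Qed.

Lemma map_share d : share map_triangles (inl (src d)) (inl (src (alpha d))).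
Proof.
apply/existsP; exists (half_edge_triangle map_nx map_org (d, A0)).
by rewrite mem_triangles /half_edge_triangle !inE !eqxx !orbT.
Qed.

(** * Euler's formula for the map *)

Lemma card_porbits_sigma : #|porbits sigma| = #|V|.
Proof.
have fP (v : V) : {d | src d = v} := cid (src_surj v).
rewrite -(card_in_imset (D := (predT : {pred V}))
  (f := fun v => porbit sigma (sval (fP v)))).
  congr #|pred_of_set _|; apply/finset.setP=> A; apply/imsetP/imsetP => -[].
    move=> d _ ->; exists (src d) => //; apply/eqP; rewrite eq_porbit_mem.
    by apply: src_porbit; case: (fP _).
  by move=> v _ ->; exists (sval (fP v)).
move=> u v _ _ /eqP; rewrite eq_porbit_mem => /porbitP[k fuv].
rewrite -(svalP (fP u)) -(svalP (fP v)) fuv.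
elim: k {fuv} => [|k IH]; first by rewrite expg0 perm1.
by rewrite expgSr permM src_sigma.
Qed.

(** This is V - E + F = 2 - 2g, doubled and free of subtraction, with 2E = [#|D|]. Connectedness
    leaves a single label in [involution_cycles]. *)
Lemma map_genus : exists g, (#|V| + #|porbits phi| + g.*2).*2 = #|D| + 4.
Proof.
have [f [fs fa]] := involution_cycles sigma alphaK.
have -> : [set d | alpha d != d] = [set: D]%SET.
  apply/finset.setP=> d; rewrite !inE; apply: contraNneq (src_alpha_neq d) => e.
  by rewrite {1}e.
rewrite cardsT card_porbits_sigma => le ev ev2.
have f_const d e : f d = f e.
  have /connectP[p] := map_connected (src d) (src e).
  have fsrc a b : src a = src b -> f a = f b.
    move/src_porbit/porbitP=> [k ->]; elim: k => [|k IH]; first by rewrite expg0 perm1.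
    by rewrite expgSr permM fs.
  elim: p d => [|w p IH] d /=; first by move=> _ /esym/fsrc.
  case/andP=> /existsP[a /andP[/eqP ad /eqP <-]] pw lw.
  by rewrite -(fsrc _ _ ad) -(fa a); apply: IH.
have im1 : #|f @: D| <= 1.
  apply/card_le1P => _ /imsetP[d _ ->] y.
  by apply/imsetP/eqP => [[e _ ->]|->]; [exact: f_const|exists d].
(* Half the defect E + 2 - V - F: nonnegative by the inequality and even by the parity statement. *)
exists ((#|D|./2 + 2 - (#|V| + #|porbits phi|)) ./2); lia.
Qed.

(** The complex has V + 2E + F vertices, 9E edges and 6E triangles, where E is the number of edges
    of the map, so its characteristic is V - E + F. *)
Lemma map_euler g : (#|V| + #|porbits phi| + g.*2).*2 = #|D| + 4 ->
  euler_characteristic map_triangles = (2 - 2 * g%:Z)%R.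
Proof.
move=> eg.
have := card_half_edge_edges map_nxK map_twK map_org_tw map_org_nx_neq
  map_org_inj map_apex_neq.
have := card_half_edge_triangles map_nxK map_twK map_org_tw map_org_nx_neq
  map_org_inj map_apex_neq.
rewrite card_prod card_corner /euler_characteristic !card_sum card_sig -/map_triangles.
have -> : #|[pred f | f \in porbits phi]| = #|porbits phi| by apply: eq_card.
lia.
Qed.
End CombinatorialMap.

Lemma map_embeddable (R : realType) (G : sgraph) (D : finType)
    (alpha sigma : {perm D}) (src : D -> G) (x0 : G) :
  (forall d, alpha (alpha d) = d) ->
  (forall d, src (sigma d) = src d) ->
  (forall d e, src d = src e -> d \in porbit sigma e) ->
  (forall x, exists d, src d = x) ->
  (forall d e, src d = src e -> src (alpha d) = src (alpha e) -> d = e) ->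
  (forall d, sigma d != d) ->
  (forall x y, reflect (exists d, src d = x /\ src (alpha d) = y) (adj x y)) ->
  (forall x y, connect (@adj G) x y) ->
  exists g, embeddable_in_genus R G g /\
    (#|G| + #|porbits (alpha * sigma)| + g.*2).*2 = #|D| + 4.
Proof.
move=> alphaK src_sigma src_porbit src_surj dart_inj sigma_neq adjP conn.
have src_alpha_neq d : src (alpha d) != src d.
  apply/negP=> /eqP e; have : adj (src d) (src d) by apply/adjP; exists d.
  by rewrite adj_irrefl.
have map_connected x y : connect
    (fun u v => [exists d, (src d == u) && (src (alpha d) == v)]) x y.
  rewrite -(eq_connect (e := @adj G)) // => u v; apply/adjP/existsP => -[d].
    by case=> <- <-; exists d; rewrite !eqxx.
  by case/andP=> /eqP ? /eqP ?; exists d.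
have [g eg] := map_genus alphaK src_sigma src_porbit src_surj src_alpha_neq map_connected.
pose T := map_triangles alpha sigma src.
exists g; split=> //; exists (set_type (realization T R)); split.
  exists (map_vertex G alpha sigma), T; split.
  - exact: (map_closed_surface alphaK src_sigma src_porbit src_surj
      src_alpha_neq dart_inj sigma_neq map_connected x0).
  - exact: (map_orientable alphaK src_sigma src_alpha_neq dart_inj sigma_neq).
  - exact: (map_euler alphaK src_sigma src_alpha_neq dart_inj sigma_neq eg).
  (* The surface is taken to be the realization itself. *)
  - by exists id, id; split=> // x; exact: cvg_id.
pose i (x : G) : map_vertex G alpha sigma := inl x.
have i_inj : injective i by move=> x y [].
have i_adj x y : adj x y -> share T (i x) (i y).
  by case/adjP=> d [<- <-]; exact: map_share.
have i_mem x : share T (i x) (i x).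
  have [d <-] := src_surj x.
  have /existsP[t /and3P[tT dt _]] := map_share alpha sigma src d.
  by apply/existsP; exists t; rewrite tT dt.
exists (straight_vertex R i_mem), (straight_arc i_mem).
exact: straight_embedding.
Qed.

(** * Pancake graphs *)

Section PancakeMap.
Local Open Scope group_scope.
Variable n : nat.
Hypothesis n_gt3 : 3 < n.
Implicit Types (p q : {perm 'I_n}) (k : 'I_n.-1) (j : 'I_n).

(** Index [k] stands for the reversal r_(k+2), acting on the positions 0 to k+1. *)
Definition flip_nat (k j : nat) := if j < k.+2 then k.+1 - j else j.

Lemma flip_natK k : involutive (flip_nat k).
Proof. by move=> j; rewrite /flip_nat; do 2?case: ifP; lia. Qed.

Lemma flip_nat_ltn k j : flip_nat k j < n.
Proof. by rewrite /flip_nat; have := ltn_ord k; have := ltn_ord j; case: ifP; lia. Qed.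

Lemma flip_ord_inj k : injective (fun j => Ordinal (flip_nat_ltn k j)).
Proof.
by move=> i j /(congr1 val) /= /(can_inj (flip_natK k)) /val_inj.
Qed.

Definition flip k : {perm 'I_n} := perm (@flip_ord_inj k).

Lemma flipE k j : flip k j = flip_nat k j :> nat.
Proof. by rewrite permE. Qed.

Lemma flipK k : flip k * flip k = 1.
Proof. by apply/permP=> j; apply: val_inj; rewrite permM perm1 /= !flipE flip_natK. Qed.

Lemma flip_inj : injective flip.
Proof.
move=> k k' /permP /(_ (Ordinal (ltn_trans (isT : 0 < 3) n_gt3))) /(congr1 val) /=.
by rewrite !flipE /flip_nat /= !subn0 => -[]; exact: val_inj.
Qed.

Lemma nth_codom_perm p x j : nth x (codom p) j = p j.
Proof. by rewrite codomE (nth_map j) ?size_enum_ord // nth_ord_enum. Qed.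

(** In a product the left factor acts first, so multiplying by [flip k] on the left permutes the
    positions of the word. *)
Lemma codom_flip k p : codom (flip k * p) = prefix_reversal k.+2 (codom p).
Proof.
have szp q : size (codom q) = n by rewrite size_codom card_ord.
have k_le : k.+2 <= n by have := ltn_ord k; lia.
have st : size (take k.+2 (codom p)) = k.+2 by rewrite size_takel ?szp.
have x0 : 'I_n := Ordinal (ltn_trans (isT : 0 < 3) n_gt3).
apply: (@eq_from_nth _ x0) => [|i].
  by rewrite /prefix_reversal size_cat size_rev st size_drop !szp subnKC.
rewrite szp => i_lt; have -> : i = Ordinal i_lt by [].
rewrite nth_codom_perm permM -(nth_codom_perm p x0) flipE /flip_nat.
rewrite /prefix_reversal nth_cat size_rev st /=; case: ltnP => ik.
  by rewrite nth_rev ?st // nth_take ?subSS //; lia.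
by rewrite nth_drop subnKC.
Qed.

Lemma pancake_adjP p q : reflect (exists k, q = flip k * p) (pancake_adj p q).
Proof.
apply: (iffP existsP) => [[i /andP[i2 /eqP E]]|[k ->]].
  have k_lt : i - 2 < n.-1 by have := ltn_ord i; lia.
  exists (Ordinal k_lt); apply/permP=> j.
  rewrite -!(nth_codom_perm _ j) codom_flip E /=.
  by have -> : (i - 2).+2 = i by lia.
have k_lt : k.+2 < n.+1 by have := ltn_ord k; lia.
by exists (Ordinal k_lt); rewrite codom_flip eqxx.
Qed.

(* The dart (p, k) is the edge from p along r_(k+2). *)
Definition dart := ({perm 'I_n} * 'I_n.-1)%type.

Definition across (d : dart) : dart := (flip d.2 * d.1, d.2).

Lemma acrossK : involutive across.
Proof. by case=> p k; rewrite /across /= mulgA flipK mul1g. Qed.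

(** * The rotation system of the pancake graph *)

Definition turn (d : dart) : dart :=
  (d.1, if odd_perm d.1 then ord_pred d.2 else ordS d.2).

Lemma turn_inj : injective turn.
Proof.
case=> p k [q k'] [->]; case: (odd_perm q).
  by move/(can_inj (@ord_predK _)) ->.
by move/ordS_inj ->.
Qed.

Definition pancake_alpha : {perm dart} := perm (can_inj acrossK).
Definition pancake_sigma : {perm dart} := perm turn_inj.

Local Notation phi := (pancake_alpha * pancake_sigma).

Lemma iter_ordS m i (k : 'I_m) : iter i (@ordS m) k = (k + i) %% m :> nat.
Proof.
elim: i => [|i IH] /=; first by rewrite addn0 modn_small.
by rewrite IH -addn1 modnDml addn1 addnS.
Qed.

Lemma ordS_trans m (k k' : 'I_m) : exists i, k' = iter i (@ordS m) k.
Proof.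
exists (m - k + k'); apply: ord_inj; rewrite iter_ordS addnA subnKC; last exact: ltnW.
by rewrite modnDl modn_small.
Qed.

Lemma turn_trans (d e : dart) : d.1 = e.1 -> d \in porbit pancake_sigma e.
Proof.
case: d e => p k [q k'] /= ->; case oq: (odd_perm q).
  (* At an odd permutation [turn] steps downwards, so the orbit is traversed from the other end. *)
  rewrite porbit_sym; have [i ->] := ordS_trans k k'.
  elim: i => [|i IH] /=; first exact: porbit_id.
  apply: etrans IH; rewrite -!eq_porbit_mem; congr (_ == _).
  rewrite -(porbit_perm _ 1 (q, ordS _)) expg1 permE /turn /= oq.
  by rewrite ordSK.
have [i ->] := ordS_trans k' k.
elim: i => [|i IH] /=; first exact: porbit_id.
apply: etrans IH; rewrite -!eq_porbit_mem; congr (_ == _).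
by rewrite -(porbit_perm _ 1 (q, iter _ _ _)) expg1 permE /turn /= oq.
Qed.

(* Two flips bring the largest misplaced entry first to the front, then home. *)
Lemma connect_sorted_tail m (r : {perm 'I_n}) :
  m <= n -> (forall j, m <= j -> r j = j) -> connect (@pancake_adj n) r 1.
Proof.
have adj_flip k p : pancake_adj p (flip k * p) by apply/pancake_adjP; exists k.
elim: m r => [|m IH] r.
  move=> _ r1; suff -> : r = 1 by exact: connect0.
  by apply/permP=> j; rewrite perm1 r1.
move=> mn rfix; pose M := Ordinal mn; set j := r^-1 M.
have rj : r j = M by rewrite permKV.
have jm : j <= m.
  rewrite leqNgt; apply/negP=> mj; have := rfix _ mj.
  by rewrite rj => /(congr1 val) /= e; move: mj; rewrite -/j -e ltnn.
have [e|ne] := eqVneq (j : nat) m.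
  apply: IH (ltnW mn) _ => i; rewrite leq_eqVlt => /orP[/eqP e'|/rfix //].
  have ji : j = i by apply: ord_inj; rewrite e.
  by rewrite -ji rj; apply: ord_inj; rewrite e.
have mk : m.-1 < n.-1 by lia.
(* [k2] reverses the positions 0 to m and so brings the front entry to position m; [k1] below brings
   position j to the front. *)
pose k2 := Ordinal mk.
have stp (s : {perm 'I_n}) : s (Ordinal (ltn_trans (isT : 0 < 3) n_gt3)) = M ->
    (forall i : 'I_n, m.+1 <= i -> s i = i) -> connect (@pancake_adj n) s 1.
  move=> s0 sfix; apply: connect_trans (connect1 (adj_flip k2 s)) _.
  apply: IH (ltnW mn) _ => i mi; rewrite permM.
  case: (eqVneq (i : nat) m) => [e|ne'].
    have -> : flip k2 i = Ordinal (ltn_trans (isT : 0 < 3) n_gt3).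
      by apply: val_inj; rewrite /= flipE /flip_nat /=; case: ifP; lia.
    by rewrite s0; apply: val_inj.
  have -> : flip k2 i = i.
    by apply: val_inj; rewrite /= flipE /flip_nat /=; case: ifP; lia.
  by apply: sfix; lia.
case: (posnP j) => [j0|j0].
  by apply: stp => //; rewrite -rj; congr (r _); apply: val_inj.
have jk : j.-1 < n.-1 by have := ltn_ord j; lia.
pose k1 := Ordinal jk.
apply: connect_trans (connect1 (adj_flip k1 r)) _.
apply: stp => [|i mi]; rewrite permM.
  rewrite -rj; congr (r _); apply: val_inj.
  by rewrite /= flipE /flip_nat /=; lia.
have -> : flip k1 i = i.
  by apply: val_inj; rewrite /= flipE /flip_nat /=; case: ifP; lia.
exact: rfix.
Qed.

Lemma pancake_connected p q : connect (@pancake_adj n) p q.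
Proof.
have to1 (r : {perm 'I_n}) : connect (@pancake_adj n) r 1.
  by apply: connect_sorted_tail (leqnn n) _ => j; have := ltn_ord j; lia.
apply: connect_trans (to1 p) _.
by rewrite (sym_connect_sym (@pancake_adj_sym n)); exact: to1.
Qed.

Lemma pancake_sigma_neq d : pancake_sigma d != d.
Proof.
case: d => p k; rewrite permE /turn xpair_eqE eqxx /=.
have ne (i : 'I_n.-1) : ordS i != i.
  rewrite -val_eqE /=; have := ltn_ord i; rewrite leq_eqVlt => /orP[/eqP e|h].
    by rewrite e modnn; lia.
  by rewrite modn_small //; lia.
by case: ifP => _ //; rewrite -(inj_eq (@ordS_inj _)) ord_predK eq_sym.
Qed.

(** * Hexagonal faces *)

Lemma hexagon_index_proof (b : bool) : b < n.-1.
Proof. by case: b; lia. Qed.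

(* r_3 at even permutations, r_2 at odd ones *)
Definition hexagon_index p : 'I_n.-1 := Ordinal (hexagon_index_proof (~~ odd_perm p)).

Definition hexagon_dart p : dart := (p, hexagon_index p).

Definition hexagon_next p := flip (hexagon_index p) * p.

(** Reversing two or three entries only exchanges the outer ones. *)
Lemma odd_flip (k : 'I_n.-1) : k < 2 -> odd_perm (flip k).
Proof.
move=> k2; have k_lt : k.+1 < n by have := ltn_ord k; lia.
pose z : 'I_n := Ordinal (ltn_trans (isT : 0 < 3) n_gt3).
pose w : 'I_n := Ordinal k_lt.
suff -> : flip k = tperm z w by rewrite odd_tperm.
apply/permP=> j; apply: ord_inj; rewrite flipE /flip_nat.
case: tpermP => [->|->|jz jw] /=; rewrite ?subn0 ?ltnSn ?subnn //.
have jz' : j <> 0 :> nat by move=> e; apply: jz; apply: ord_inj.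
have jw' : j <> k.+1 :> nat by move=> e; apply: jw; apply: ord_inj.
by case: ifP; lia.
Qed.

Lemma odd_hexagon_next p : odd_perm (hexagon_next p) = ~~ odd_perm p.
Proof.
by rewrite odd_permM odd_flip //=; case: odd_perm.
Qed.

(** After r_3 from an even permutation the rotation steps down to r_2; after r_2 from an odd one it
    steps up to r_3. *)
Lemma phi_hexagon p : phi (hexagon_dart p) = hexagon_dart (hexagon_next p).
Proof.
rewrite permM !permE /turn /across /= -/(hexagon_next p); congr pair.
rewrite odd_hexagon_next; apply: ord_inj.
rewrite [RHS]/= odd_hexagon_next; case op: (odd_perm p) => /=; rewrite op /=.
  by rewrite modn_small //; lia.
by rewrite add0n modnn.
Qed.

(** The product of r_2 and r_3 is a 3-cycle on the first three positions, so alternating them six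
    times gives the identity. *)
Lemma hexagon_next6 p : iter 6 hexagon_next p = p.
Proof.
have step i q (b : bool) : odd_perm (iter i hexagon_next p) = b ->
    forall j, iter i.+1 hexagon_next p j =
      iter i hexagon_next p (flip (Ordinal (hexagon_index_proof (~~ b))) j).
  by move=> <- j; rewrite iterS permM.
have par i : odd_perm (iter i hexagon_next p) = odd i (+) odd_perm p.
  by elim: i => [//|i IH]; rewrite iterS odd_hexagon_next IH addNb.
apply/permP=> j.
rewrite !(step _ p _ (par _)); congr (p _); apply: ord_inj; rewrite !flipE /=.
by case: (odd_perm p); rewrite /flip_nat /=; case: (nat_of_ord j) => [|[|[|?]]].
Qed.

Lemma card_hexagon_porbit p : #|porbit phi (hexagon_dart p)| <= 6.
Proof.
have phiE i : (phi ^+ i) (hexagon_dart p) = hexagon_dart (iter i hexagon_next p).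
  elim: i => [|i IH]; first by rewrite expg0 perm1.
  by rewrite expgSr permM IH phi_hexagon.
apply: leq_trans (_ : #|[set (phi ^+ (i : 'I_6)) (hexagon_dart p) | i in 'I_6]%SET| <= _).
  apply: subset_leq_card; apply/fintype.subsetP=> d /porbitP[i ->].
  apply/imsetP; exists (Ordinal (ltn_pmod i (isT : 0 < 6))) => //=.
  rewrite !phiE {1}(divn_eq i 6) addnC iterD; congr (hexagon_dart (iter _ _ _)).
  by elim: (i %/ 6) => [//|m IH]; rewrite mulSn iterD IH hexagon_next6.
by apply: leq_trans (leq_imset_card _ _) _; rewrite card_ord.
Qed.

(** The [n!] hexagon darts, one per permutation, are covered by cycles of length at most six. *)
Lemma card_porbits_phi : n`! <= #|porbits phi| * 6.
Proof.
pose A := [set porbit phi (hexagon_dart p) | p : {perm 'I_n}]%SET.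
apply: leq_trans (_ : #|A| * 6 <= _); last first.
  rewrite leq_mul2r subset_leq_card //; apply/fintype.subsetP=> _ /imsetP[p _ ->].
  exact: imset_f.
have <- : #|[set hexagon_dart p | p : {perm 'I_n}]%SET| = n`!.
  rewrite card_imset; last by move=> p q [].
  by rewrite -card_Sn; apply: eq_card => p; rewrite inE.
apply: leq_trans (_ : #|finset.cover A| <= _).
  apply: subset_leq_card; apply/fintype.subsetP=> _ /imsetP[p _ ->].
  apply/bigcupP; exists (porbit phi (hexagon_dart p)); first exact: imset_f.
  exact: porbit_id.
apply: leq_trans (leq_card_cover A) _; rewrite -sum_nat_const.
by apply: leq_sum => _ /imsetP[p _ ->]; exact: card_hexagon_porbit.
Qed.

(** The inequality is the final bound times 12. It follows from 2(n! + F + 2g) = n!(n - 1) + 4 and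
    6F >= n!, where F is the number of faces. *)
Lemma pancake_embeddable (R : realType) : exists g : nat,
  embeddable_in_genus R (pancake n) g /\ 12 * g + 10 * n`! <= 3 * (n`! * n) + 12.
Proof.
have k_lt : 0 < n.-1 by lia.
have aE d : pancake_alpha d = across d by rewrite permE.
have aK d : pancake_alpha (pancake_alpha d) = d by rewrite !aE acrossK.
have sE d : (pancake_sigma d).1 = d.1 by rewrite permE.
have surj (p : {perm 'I_n}) : exists d : dart, d.1 = p by exists (p, Ordinal k_lt).
have inj (d e : dart) : d.1 = e.1 -> (pancake_alpha d).1 = (pancake_alpha e).1 -> d = e.
  by case: d e => p k [q k'] /= ->; rewrite !aE => /= /mulIg/flip_inj ->.
have dartP (p q : pancake n) :
    reflect (exists d : dart, d.1 = p /\ (pancake_alpha d).1 = q) (adj p q).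
  apply: (iffP (pancake_adjP p q)) => [[k ->]|[[r k] [/= <- <-]]].
    by exists (p, k); rewrite aE.
  by exists k; rewrite aE.
have [g [emb eg]] := @map_embeddable R (pancake n) _ _ _ _ 1
  aK sE turn_trans surj inj pancake_sigma_neq dartP pancake_connected.
exists g; split=> //; have := card_porbits_phi; move: eg; rewrite card_prod card_ord.
have -> : #|pancake n| = n`! by rewrite -card_Sn; apply: eq_card => p; rewrite inE.
by nia.
Qed.
End PancakeMap.

(** * The genus as a minimum, and the bound *)

Local Open Scope ring_scope.

Lemma is_genus_exists (R : realType) (G : sgraph) (g : nat) :
  embeddable_in_genus R G g -> exists2 g0, is_genus R G g0 & (g0 <= g)%N.
Proof.
move=> eg; have ex : exists m, `[< embeddable_in_genus R G m >].
  by exists g; exact/asboolP.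
case: (ex_minnP ex) => m /asboolP em mmin; exists m; last exact/mmin/asboolP.
by split=> // g' /asboolP/mmin.
Qed.

Theorem theorem4p1 (R : realType) (n : nat) (hn : (3 < n)%N) :
  exists g : nat, is_genus R (pancake n) g /\
    (g%:R : R) <= n`!%:R * ((3 * n%:R - 10) / 12) + 1.
Proof.
have [g [/is_genus_exists[g0 gen le] ineq]] := pancake_embeddable hn R.
exists g0; split=> //.
have {}ineq : (12 * g0 + 10 * n`! <= 3 * (n`! * n) + 12)%N by lia.
move: ineq; rewrite -(ler_nat R) !natrD !natrM; lra.
Qed.
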